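(* Let $(S_n)_{n\ge1}$ be a demisubmartingale and let $\tau$ be a stopping time such that, for every $j\ge1$, $I\{\tau\le j\}$ is a componentwise nonincreasing function of $S_1,\ldots,S_j$. Suppose that at least one of the following conditions holds: ($A_1$) $\tau$ is bounded (there is a constant $c$ with $\tau\le c$ a.s.); ($A_2$) $(S_n)_{n\ge1}$ is bounded (there is a constant $M<\infty$ with $|S_n|\le M$ for all $n$) and $\tau$ is finite a.s.; ($A_3$) $E(\tau)<\infty$ and there is $M>0$ such that $|S_k-S_{k-1}|\le M$ for all $k\ge2$. Then $E(S_\tau)\ge E(S_1)$.
   Context: All random variables live on one probability space, and functions are understood to be Borel measurable. $I\{A\}$ denotes the indicator of the event $A$. A sequence of $L^1$ random variables $(S_n)_{n\ge1}$ is a demisubmartingale if for all $j\ge1$, $E[(S_{j+1}-S_j)f(S_1,\ldots,S_j)]\ge 0$ for all nonnegative componentwise nondecreasing functions $f:\mathbb{R}^j\to\mathbb{R}$ for which the expectation is defined. A stopping time is a random variable $\tau$ with values in $\{1,2,\ldots\}\cup\{\infty\}$ with $\{\tau\le j\}\in\sigma(S_1,\ldots,S_j)$ for every $j\ge1$. ''$I\{\tau\le j\}$ is a componentwise nonincreasing function of $S_1,\ldots,S_j$'' means $I\{\tau\le j\}=h_j(S_1,\ldots,S_j)$ for some componentwise nonincreasing function $h_j$ on $\mathbb{R}^j$. *)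

(* Defs.v *)
From HB Require Import structures.
From mathcomp Require Export all_boot all_order all_algebra.
From mathcomp Require Export all_classical all_reals all_analysis.
Set Implicit Arguments.
Unset Strict Implicit.
Unset Printing Implicit Defensive.
Import Order.TTheory GRing.Theory Num.Theory.
Local Open Scope classical_set_scope.
Local Open Scope ring_scope.

Definition cw_nondecreasing (R : realType) (j : nat) (f : j.-tuple R -> R) :=
  forall u v : j.-tuple R, (forall i, tnth u i <= tnth v i) -> f u <= f v.

Definition cw_nonincreasing (R : realType) (j : nat) (f : j.-tuple R -> R) :=
  forall u v : j.-tuple R, (forall i, tnth u i <= tnth v i) -> f v <= f u.

(* Sequences are indexed from 1: the entry S 0 is a dummy and is never used. *)
Definition initial (T R : Type) (S : nat -> T -> R) (j : nat) (x : T) :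
  j.-tuple R := [tuple S i.+1 x | i < j].

(* The expectation exists in the extended sense, i.e., it is not of the form
   +oo - oo (which the library's total integral sets to -oo). *)
Definition expectation_defined (d : measure_display) (T : measurableType d)
    (R : realType) (P : probability T R) (Z : T -> R) :=
  (\int[P]_x (EFin \o Z)^\+ x +? - \int[P]_x (EFin \o Z)^\- x)%E.

Definition demisubmartingale (d : measure_display) (T : measurableType d)
    (R : realType) (P : probability T R) (S : nat -> {RV P >-> R}) :=
  (forall n, (1 <= n)%N -> (S n : T -> R) \in Lfun P 1) /\
  forall j, (1 <= j)%N -> forall f : j.-tuple R -> R,
    measurable_fun setT f -> (forall u, 0 <= f u) -> cw_nondecreasing f ->
    let Z x := (S j.+1 x - S j x) * f (initial S j x) in
    expectation_defined P Z -> (0 <= 'E_P[Z])%E.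

(* Times with values in {0,1,2,...} U {oo}: None stands for oo. *)
Definition etime (R : realType) (t : option nat) : \bar R :=
  if t is Some n then n%:R%:E else +oo%E.

Definition by_time (R : realType) (T : Type) (tau : T -> option nat)
    (j : nat) : set T :=
  [set x | (etime R (tau x) <= j%:R%:E)%E].

Definition stopping_time (d : measure_display) (T : measurableType d)
    (R : realType) (P : probability T R) (S : nat -> {RV P >-> R})
    (tau : T -> option nat) :=
  (forall x, (1 <= etime R (tau x))%E) /\
  forall j, (1 <= j)%N ->
    g_sigma_preimage (fun i : 'I_j => S i.+1 : T -> R) (by_time R tau j).

(* The value 0 on {tau = oo} is a convention, used only where that event is
   negligible. *)
Definition stopped (T : Type) (R : realType) (S : nat -> T -> R)
    (tau : T -> option nat) (x : T) : R :=
  if tau x is Some n then S n x else 0.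

(* Main.v *)
Require Import Defs.
From mathcomp Require Import measurable_realfun.

(** The stopped process [S_(min tau n)] has increments
    [(S_(n+1) - S_n) * I{tau > n}]. Since [I{tau <= n}] is a componentwise
    nonincreasing function of [S_1, ..., S_n], the indicator [I{tau > n}] is a
    nonnegative componentwise nondecreasing one, so it is a legitimate test
    function in the demisubmartingale inequality: the increments have nonnegative
    expectation ([expectation_stopped_upto_homo]). As [tau >= 1], the stopped
    process starts at [S_1], whence [E(S_1) <= E(S_(min tau n))] for all [n >= 1]
    ([expectation_stopped_upto_ge]).

    Under each of the three conditions [tau] is almost surely finite, so that
    [S_(min tau n)] is almost surely eventually equal to [S_tau], and there is an
    integrable bound on the stopped process: [|S_1| + ... + |S_N|] when
    [tau <= N], the constant [M] when [|S_n| <= M], and [|S_1| + M * tau] when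
    the increments of [S] are bounded by [M] and [E(tau)] is finite. Dominated
    convergence ([expectation_stopped_dominated]) then gives the result. *)

Set Implicit Arguments.
Unset Strict Implicit.
Unset Printing Implicit Defensive.
Import Order.TTheory GRing.Theory Num.Theory.
Local Open Scope classical_set_scope.
Local Open Scope ring_scope.

(** * Times and the stopped process *)

(** The minimum of a time and [n], with [None] read as infinity. *)
Definition capped (t : option nat) (n : nat) : nat :=
  if t is Some k then minn k n else n.

(** The process [S] stopped at [tau], observed at time [n], i.e.
    [S_(min tau n)]. *)
Definition stopped_upto (T : Type) (R : realType) (S : nat -> T -> R)
    (tau : T -> option nat) (n : nat) (x : T) : R := S (capped (tau x) n) x.

(** [tau] satisfies the monotonicity hypothesis: each indicator of [tau <= j] is
    a Borel, componentwise nonincreasing function of [S_1, ..., S_j]. *)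
Definition nonincreasing_time (T : Type) (R : realType) (S : nat -> T -> R)
    (tau : T -> option nat) :=
  forall j, (1 <= j)%N -> exists h : j.-tuple R -> R,
    [/\ measurable_fun setT h, cw_nonincreasing h &
      forall x, \1_(by_time R tau j) x = h (initial S j x)].

Lemma by_timeE (R : realType) (T : Type) (tau : T -> option nat) (j : nat)
    (x : T) :
  by_time R tau j x = (if tau x is Some k then (k <= j)%N : Prop else False).
Proof.
rewrite /by_time /=; case: (tau x) => [k|] /=.
  by rewrite lee_fin ler_nat.
by apply/propext; split.
Qed.

Lemma etime_ge1 (R : realType) (t : option nat) :
  (1 <= etime R t)%E -> t != Some 0%N.
Proof. by case: t => [[|k]|] //=; rewrite lee_fin ler10. Qed.

Lemma capped1 (t : option nat) : t != Some 0%N -> capped t 1 = 1%N.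
Proof. by case: t => [[|[|k]]|]. Qed.

(** * Measurability of random times *)

Section MeasurableTime.
Context (d : measure_display) (T : measurableType d) (R : realType).
Implicit Type tau : T -> option nat.

Lemma g_sigma_preimage_measurable (n : nat) (X : 'I_n -> {mfun T >-> R}) :
  g_sigma_preimage (fun i => X i : T -> R) `<=` d.-measurable.
Proof.
apply: smallest_sub; first exact: sigma_algebra_measurable.
elim/big_ind: _ => [A []|A B sA sB C [/sA|/sB]//|i _ _ [B mB <-]].
by rewrite setTI; exact: measurable_funPTI.
Qed.

Lemma measurable_time_fiber tau :
  (forall n, measurable (by_time R tau n)) ->
  forall t, measurable (tau @^-1` [set t]).
Proof.
move=> mtau [n|].
  have -> : tau @^-1` [set Some n] =
      by_time R tau n `\` \bigcup_(k in `I_n) by_time R tau k.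
    apply/seteqP; split => x /=.
      move=> tx; split; first by rewrite by_timeE tx.
      by move=> [k /= kn]; rewrite by_timeE tx leqNgt kn.
    rewrite by_timeE; case tx: (tau x) => [m|] [] // mn H.
    congr Some; apply/eqP; rewrite eqn_leq mn leqNgt; apply/negP => {}mn.
    by apply: H; exists m => //; rewrite by_timeE tx.
  apply: measurableD => //.
  by apply: fin_bigcup_measurable.
have -> : tau @^-1` [set None] = ~` \bigcup_k by_time R tau k.
  apply/seteqP; split => x /=.
    by move=> tx [k _]; rewrite by_timeE tx.
  case tx: (tau x) => [m|] // H; exfalso; apply: H.
  by exists m => //; rewrite by_timeE tx.
by apply: measurableC; exact: bigcupT_measurable.
Qed.

(** Evaluating a family of measurable functions, indexed by the countable set of
    times, at a random time. *)
Lemma measurable_fun_at_time (d' : measure_display) (U : measurableType d')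
    (tau : T -> option nat) (F : option nat -> T -> U) :
  (forall t, measurable (tau @^-1` [set t])) ->
  (forall t, measurable_fun setT (F t)) ->
  measurable_fun setT (fun x => F (tau x) x).
Proof.
move=> mtau mF _ B mB; rewrite setTI.
have -> : (fun x => F (tau x) x) @^-1` B =
    \bigcup_t (tau @^-1` [set t] `&` F t @^-1` B).
  apply/seteqP; split => x /=; first by move=> Bx; exists (tau x).
  by move=> [t _ [/= ->]].
apply: countable_bigcupT_measurable => // t; apply: measurableI => //.
by rewrite -[X in measurable X]setTI; exact: mF.
Qed.

End MeasurableTime.

(** * Demisubmartingales stopped at a bounded time, and passage to the limit *)

Section Demisubmartingale.
Context (d : measure_display) (T : measurableType d) (R : realType)
  (P : probability T R).
Implicit Types (S : nat -> {RV P >-> R}) (tau : T -> option nat).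

Lemma measurable_by_time S tau : stopping_time S tau ->
  forall j, measurable (by_time R tau j).
Proof.
move=> [tau1 htau] [|j].
  rewrite (_ : by_time R tau 0 = set0)//; apply/seteqP; split => // x.
  by rewrite by_timeE; case tx: (tau x) (etime_ge1 (tau1 x)) => [[]|].
by apply: (@g_sigma_preimage_measurable _ _ _ _ (fun i : 'I_j.+1 => S i.+1));
  exact: htau.
Qed.

Lemma stopped_upto1 (S : nat -> T -> R) tau :
  (forall x, 1 <= etime R (tau x))%E -> stopped_upto S tau 1 = S 1%N.
Proof.
move=> tau1; apply/funext => x.
by rewrite /stopped_upto capped1// (etime_ge1 (tau1 x)).
Qed.

(** The increment of the stopped process: it moves with [S] on [tau > n] and is
    frozen on [tau <= n]. *)
Lemma stopped_uptoS (S : nat -> T -> R) tau n x :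
  stopped_upto S tau n.+1 x =
  stopped_upto S tau n x + (S n.+1 x - S n x) * (1 - \1_(by_time R tau n) x).
Proof.
rewrite /stopped_upto indicE /capped.
have := by_timeE R tau n x.
case: (tau x) => [k|] H; last first.
  by rewrite memNset ?H// subr0 mulr1 addrC subrK.
have [kn|nk] := leqP k n.
  by rewrite mem_set ?H// subrr mulr0 addr0 (minn_idPl (leqW kn)).
by rewrite memNset ?H ?(minn_idPr nk) ?subr0 ?mulr1 1?addrC ?subrK// leqNgt nk.
Qed.

(** The increments of the stopped process are bounded by those of [S]; the
    dummy [S 0] is the reason for starting at index 1. *)
Lemma integrable_stopped_upto S tau n : demisubmartingale S ->
  stopping_time S tau ->
  P.-integrable setT (EFin \o stopped_upto S tau n.+1).
Proof.
move=> [iS _] htau; have mtau := measurable_by_time htau.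
have iS1 m : P.-integrable setT (EFin \o S m.+1).
  by apply/Lfun1_integrable; exact: iS.
elim: n => [|n IHn].
  by rewrite (stopped_upto1 _ htau.1).
pose Z x := (S n.+2 x - S n.+1 x) * (1 - \1_(by_time R tau n.+1) x).
rewrite (_ : _ \o _ = (EFin \o stopped_upto S tau n.+1) \+ (EFin \o Z))%E.
  apply: integrableD => //.
  apply: (le_integrable measurableT _ _
    (integrableB measurableT (iS1 n.+1) (iS1 n))).
    apply/measurable_EFinP; apply: measurable_funM.
      exact: measurable_funB.
    apply: measurable_funB; first exact: measurable_cst.
    exact: measurable_indic.
  move=> x _; rewrite lee_fin /Z normrM ler_piMr//.
  rewrite indicE; case: (_ \in _); first by rewrite subrr normr0.
  by rewrite subr0 normr1.
by apply/funext => x /=; rewrite stopped_uptoS EFinD.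
Qed.

(** The only use of the demisubmartingale inequality: the increment of the stopped
    process is [(S_(n+2) - S_(n+1)) * I{tau > n+1}], and [I{tau > n+1}] is a
    nonnegative componentwise nondecreasing function of [S_1, ..., S_(n+1)]. *)
Lemma expectation_stopped_upto_homo S tau n :
  demisubmartingale S -> stopping_time S tau ->
  nonincreasing_time S tau ->
  ('E_P[stopped_upto S tau n.+1] <= 'E_P[stopped_upto S tau n.+2])%E.
Proof.
move=> hS htau /(_ n.+1 isT)[h [mh hmono hE]].
(* The truncation at 0 makes f nonnegative on the whole space; on the range of
   S_1, ..., S_(n+1) it has no effect. *)
pose f u := Num.max 0 (1 - h u).
have fE x : f (initial S n.+1 x) = 1 - \1_(by_time R tau n.+1) x.
  rewrite /f -hE max_r// subr_ge0 indicE; by case: (_ \in _).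
pose Z x := (S n.+2 x - S n.+1 x) * f (initial S n.+1 x).
have YE : stopped_upto S tau n.+2 = stopped_upto S tau n.+1 \+ Z.
  by apply/funext => x; rewrite stopped_uptoS -fE.
have iY m := integrable_stopped_upto m hS htau.
have iZ : P.-integrable setT (EFin \o Z).
  rewrite (_ : Z = stopped_upto S tau n.+2 \- stopped_upto S tau n.+1).
    exact: (integrableB measurableT (iY _) (iY _)).
  by apply/funext => x; rewrite YE/= addrC addKr.
rewrite YE expectationD; [|exact/Lfun1_integrable..].
apply: leeDl; apply: (hS.2 n.+1 isT f).
- apply: measurable_maxr; first exact: measurable_cst.
  exact: measurable_funB.
- by move=> u; rewrite /f le_max lexx.
- move=> u v uv; rewrite /f ge_max !le_max lexx/= lerB ?orbT//.
  exact: hmono.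
- exact: integrable_add_def.
Qed.

Lemma expectation_stopped_upto_ge S tau n :
  demisubmartingale S -> stopping_time S tau ->
  nonincreasing_time S tau ->
  ('E_P[S 1%N] <= 'E_P[stopped_upto S tau n.+1])%E.
Proof.
move=> hS htau hmono; elim: n => [|n IHn].
  by rewrite (stopped_upto1 _ htau.1).
by apply: (le_trans IHn); exact: expectation_stopped_upto_homo.
Qed.

Lemma cvg_stopped_upto (S : nat -> T -> R) tau x :
  (etime R (tau x) < +oo)%E ->
  (stopped_upto S tau n.+1 x)%:E @[n --> \oo] --> (stopped S tau x)%:E.
Proof.
rewrite /stopped_upto /stopped /capped; case: (tau x) => [k _|]; last first.
  by rewrite ltxx.
apply: cvg_near_cst; exists k => // n /= kn.
by rewrite (minn_idPl (leqW kn)).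
Qed.

(** Optional stopping whenever [tau] is almost surely finite and the stopped
    process is dominated by an integrable function. *)
Lemma expectation_stopped_dominated S tau (g : T -> \bar R) :
  demisubmartingale S -> stopping_time S tau ->
  nonincreasing_time S tau ->
  {ae P, forall x, (etime R (tau x) < +oo)%E} ->
  P.-integrable setT g ->
  {ae P, forall x, forall n, (`|(stopped_upto S tau n.+1 x)%:E| <= g x)%E} ->
  ('E_P[S 1%N] <= 'E_P[stopped S tau])%E.
Proof.
move=> hS htau hmono tau_fin ig dom.
have mfib := measurable_time_fiber (measurable_by_time htau).
have mstop : measurable_fun setT (EFin \o stopped S tau).
  apply/measurable_EFinP.
  pose F t := if t is Some n then S n : T -> R else cst 0.
  rewrite (_ : stopped S tau = fun x => F (tau x) x); last first.
    by apply/funext => x; rewrite /stopped /F; case: (tau x).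
  by apply: measurable_fun_at_time => // -[n|] /=.
have iY n := integrable_stopped_upto n hS htau.
(* The sequence starts at time 1, where the stopped process is integrable. *)
have [] := @dominated_convergence _ _ _ P _ measurableT
  (fun n => EFin \o stopped_upto S tau n.+1) (EFin \o stopped S tau) g.
- by move=> n; have /integrableP[] := iY n.
- exact: mstop.
- by apply: filterS tau_fin => x tx _; exact: cvg_stopped_upto.
- exact: ig.
- by apply: filterS dom => x gx n _; exact: gx.
move=> _ _ lim.
have ES1 n := expectation_stopped_upto_ge n hS htau hmono.
rewrite unlock in ES1 *.
by apply: (cvge_ge _ lim); apply: nearW => n; exact: ES1.
Qed.

End Demisubmartingale.

Theorem theorem3p3 (d : measure_display) (T : measurableType d) (R : realType)
    (P : probability T R) (S : nat -> {RV P >-> R}) (tau : T -> option nat)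
    (hS : demisubmartingale S)
    (htau : stopping_time S tau)
    (hmono : forall j, (1 <= j)%N ->
      exists h : j.-tuple R -> R,
        [/\ measurable_fun setT h, cw_nonincreasing h &
          forall x, \1_(by_time R tau j) x = h (initial S j x)])
    (hA :
      [\/ exists c : R, {ae P, forall x, (etime R (tau x) <= c%:E)%E},
          (exists M : R, forall n, (1 <= n)%N -> forall x, `|S n x| <= M) /\
            {ae P, forall x, (etime R (tau x) < +oo)%E}
        | (\int[P]_x etime R (tau x) < +oo)%E /\
            exists2 M : R, 0 < M &
              forall k, (2 <= k)%N -> forall x, `|S k x - S k.-1 x| <= M]) :
  ('E_P[S 1%N] <= 'E_P[stopped S tau])%E.
Proof.
have tau1 x : tau x != Some 0%N by exact: (etime_ge1 (htau.1 x)).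
have iS n : P.-integrable setT (EFin \o S n.+1).
  by apply/Lfun1_integrable; exact: hS.1.
case: hA => [[c tau_c]|[[M SM] tau_fin]|[tau_int [M M0 SM]]].
(* Bounded time: the stopped process takes one of the values S_1, ..., S_N. *)
- pose N := (Num.truncn c).+1.
  apply: (@expectation_stopped_dominated _ _ _ _ S tau
    (fun x => \sum_(i < N) `|(S i.+1 x)%:E|)%E) => //.
  + by apply: filterS tau_c => x /le_lt_trans -> //; rewrite ltry.
  + by apply: integrable_sum => // i _; exact: (integrable_abse (iS i)).
  + apply: filterS tau_c => x tx n; rewrite /stopped_upto.
    case: (tau x) (tau1 x) tx => [[|k]|]//= _; rewrite lee_fin => kc.
    have kN : (minn k n < N)%N.
      apply: (leq_ltn_trans (geq_minl _ _)).
      rewrite -(ltr_nat R); apply: lt_le_trans (ltW (truncnS_gt c)).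
      by apply: lt_le_trans kc; rewrite ltr_nat.
    rewrite minnSS (bigD1 (Ordinal kN))//=; apply: leeDl.
    exact: sume_ge0.
- apply: (@expectation_stopped_dominated _ _ _ _ S tau (cst M%:E)) => //.
  + exact: finite_measure_integrable_cst.
  + apply: aeW => x n; rewrite lee_fin; apply: SM.
    by rewrite /capped; case: (tau x) (tau1 x) => [[|k]|]; rewrite ?minnSS.
(* Bounded increments: |S_(min tau n)| <= |S_1| + M * tau. *)
- have itau : P.-integrable setT (fun x => etime R (tau x)).
    apply/integrableP; split.
      apply: (@measurable_fun_at_time _ _ _ _ tau (fun t _ => etime R t)) => //.
      exact: (measurable_time_fiber (measurable_by_time htau)).
    under eq_integral => x _.
      rewrite gee0_abs; last by apply: le_trans (htau.1 x).
      over.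
    exact: tau_int.
  have tau_fin : {ae P, forall x, (etime R (tau x) < +oo)%E}.
    apply: filterS (integrable_ae measurableT itau) => x /(_ I).
    by rewrite ltey; case: (etime R (tau x)).
  apply: (@expectation_stopped_dominated _ _ _ _ S tau
    (fun x => `|(S 1%N x)%:E| + M%:E * etime R (tau x))%E) => //.
    apply: integrableD => //; first exact: (integrable_abse (iS 0%N)).
    exact: integrableZl.
  have SkM k x : `|S k.+1 x| <= `|S 1%N x| + M * k%:R.
    elim: k => [|k IHk]; first by rewrite mulr0 addr0.
    rewrite -(subrK (S k.+1 x) (S k.+2 x)) (le_trans (ler_normD _ _))//.
    by rewrite -[k.+1]addn1 natrD mulrDr mulr1 addrA [leRHS]addrC addn1 lerD// SM.
  apply: filterS tau_fin => x + n; rewrite /stopped_upto.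
  case: (tau x) (tau1 x) => [[|k]|]//= _ _.
  rewrite minnSS lee_fin (le_trans (SkM _ x))// lerD2l ler_pM2l// ler_nat.
  by rewrite (leq_trans (geq_minl _ _)).
Qed.
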